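(* Let $M>m>0$ and let $f,g,h\in L^2_\phi(\Omega)$, with $h(x)\ne 0$ for almost every $x\in\Omega$, be such that the functions $$M\cdot\frac{g}{h}-\frac{f}{h},\qquad \frac{f}{h}-m\cdot\frac{g}{h}$$ are synchronous. Then $$0\le\left|\begin{matrix}\int_\Omega\phi f^2&\int_\Omega\phi fh\\ \int_\Omega\phi fh&\int_\Omega\phi h^2\end{matrix}\right|\cdot\left|\begin{matrix}\int_\Omega\phi g^2&\int_\Omega\phi gh\\ \int_\Omega\phi gh&\int_\Omega\phi h^2\end{matrix}\right|-\left|\begin{matrix}\int_\Omega\phi fg&\int_\Omega\phi fh\\ \int_\Omega\phi gh&\int_\Omega\phi h^2\end{matrix}\right|^2\le\frac14(M-m)^2\left|\begin{matrix}\int_\Omega\phi g^2&\int_\Omega\phi gh\\ \int_\Omega\phi gh&\int_\Omega\phi h^2\end{matrix}\right|^2 .$$ The constant $\frac14$ is best possible: there is no $C<\frac14$ such that the second inequality, with $\frac14$ replaced by $C$, holds for all measure spaces $(\Omega,\Sigma,\mu)$, all measurable $\phi:\Omega\to[0,\infty)$, all $M>m>0$ and all $f,g,h\in L^2_\phi(\Omega)$ with $h\ne0$ almost everywhere such that $M\cdot\frac{g}{h}-\frac{f}{h}$ and $\frac{f}{h}-m\cdot\frac{g}{h}$ are synchronous.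
   Context: $(\Omega,\Sigma,\mu)$ is a measure space consisting of a set $\Omega$, a $\sigma$-algebra $\Sigma$ of subsets of $\Omega$ and a countably additive positive measure $\mu$ on $\Sigma$ with values in $\mathbb{R}\cup\{\infty\}$; $\phi:\Omega\to[0,\infty)$ is a measurable function. $L^2_\phi(\Omega)$ denotes the Hilbert space of all real-valued measurable functions $f$ on $\Omega$ with $\int_\Omega\phi(s)|f(s)|^2\,d\mu(s)<\infty$. $\int_\Omega\phi fg$ abbreviates $\int_\Omega\phi(x)f(x)g(x)\,d\mu(x)$ (and similarly for the other integrals), and vertical bars around an array denote the determinant. A pair of real-valued functions $(q,p)$ on $\Omega$ is called synchronous if $(q(x)-q(y))(p(x)-p(y))\ge0$ for almost every $x,y\in\Omega$ (i.e. for $\mu$-almost every $x$, the inequality holds for $\mu$-almost every $y$). *)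

(* Defs.v *)
From HB Require Import structures.
From mathcomp Require Import all_boot all_order all_algebra.
From mathcomp Require Import all_classical all_reals all_analysis.

Set Implicit Arguments.
Unset Strict Implicit.
Unset Printing Implicit Defensive.

Import Order.TTheory GRing.Theory Num.Theory.

Local Open Scope classical_set_scope.
Local Open Scope ring_scope.

Definition mx2 (R : comNzRingType) (a b c d : R) : 'M[R]_2 :=
  \matrix_(i < 2, j < 2) nth 0 (nth [::] [:: [:: a; b]; [:: c; d]] i) j.

Lemma det_mx2 (R : comNzRingType) (a b c d : R) :
  \det (mx2 a b c d) = a * d - b * c.
Proof.
rewrite (expand_det_row _ ord0) !big_ord_recl big_ord0 /cofactor !det_mx11.
by rewrite !mxE /= expr0 expr1 !mul1r mulN1r mulrN addr0.
Qed.

Definition weight (R : realType) (d : measure_display) (T : measurableType d)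
    (phi : T -> R) : Prop :=
  measurable_fun [set: T] phi /\ forall x, 0 <= phi x.

(* Elements are functions, not classes modulo a.e. equality. *)
Definition L2w (R : realType) (d : measure_display) (T : measurableType d)
    (mu : {measure set T -> \bar R}) (phi : T -> R) : set (T -> R) :=
  [set f : T -> R | measurable_fun [set: T] f /\
           (\int[mu]_x (phi x * `|f x| ^+ 2)%:E < +oo)%E].

(* The integral of phi f g; Rintegral takes the value 0 when the
   extended-real integral is infinite, which does not happen on L2w. *)
Definition wint (R : realType) (d : measure_display) (T : measurableType d)
    (mu : {measure set T -> \bar R}) (phi f g : T -> R) : R :=
  Rintegral mu [set: T] (fun x => phi x * f x * g x).

(* The exceptional null set of y may depend on x. *)
Definition synchronous (R : realType) (d : measure_display)
    (T : measurableType d) (mu : {measure set T -> \bar R})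
    (q p : T -> R) : Prop :=
  {ae mu, forall x, {ae mu, forall y, 0 <= (q x - q y) * (p x - p y)}}.

(* The quotients take the value 0 where h vanishes, which is on a null set. *)
Definition admissible (R : realType) (d : measure_display)
    (T : measurableType d) (mu : {measure set T -> \bar R})
    (phi : T -> R) (M m : R) (f g h : T -> R) : Prop :=
  [/\ L2w mu phi f, L2w mu phi g, L2w mu phi h,
      {ae mu, forall x, h x != 0} &
      synchronous mu (fun x => M * (g x / h x) - f x / h x)
                     (fun x => f x / h x - m * (g x / h x))].

(* Main.v *)
Require Import Defs.
From HB Require Import structures.
From mathcomp Require Import all_boot all_order all_algebra.
From mathcomp Require Import all_classical all_reals all_analysis.
From mathcomp Require Import measurable_realfun ring lra.

Set Implicit Arguments.
Unset Strict Implicit.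
Unset Printing Implicit Defensive.

Import Order.TTheory GRing.Theory Num.Theory.

Local Open Scope classical_set_scope.
Local Open Scope ring_scope.

(** Write D(u, v) for the determinant with rows (int phi u v, int phi u h) and
    (int phi v h, int phi h h), called [gram h u v] below.  It is a symmetric
    bilinear form in (u, v): up to a factor, the covariance of u/h and v/h for
    the weight phi h^2.  The statement is a reversed Cauchy-Schwarz inequality
    for D, of Gruss type.

    Everything rests on the Chebyshev-Korkine idea.  For fixed x, expanding
      (u(x) h(y) - u(y) h(x)) (v(x) h(y) - v(y) h(x))
    and integrating, first over y against phi, then over x against phi, gives
    2 D(u, v).  The product equals h(x)^2 h(y)^2 times the product of the
    increments of u/h and v/h, so D(u, v) >= 0 when these quotients are
    synchronous ([gram_ge0]).  The two integrations are done one after the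
    other, and only the linearity of each is used: Fubini's
    theorem would require mu to be sigma-finite.

    Taking v = u, the form D is positive semidefinite, which gives the lower
    bound by Cauchy-Schwarz ([gram_cauchy_schwarz]).  Taking u = M g - f and
    v = f - m g, the inequality D(u, v) >= 0 reads
      D(f, f) + M m D(g, g) <= (M + m) D(f, g)
    ([gram_reverse_cauchy_schwarz]), from which the upper bound follows by
    completing a square in D(f, g) ([gruss_of_reverse_cauchy_schwarz]).

    Equality with D(g, g) > 0 would need u and v above to be uncorrelated with
    the same nonzero variance while u/h and v/h are synchronous.  The
    indicators of a nested pair A, B in which A and the complement of B have
    small relative weight come arbitrarily close to this: with h = 1 and three
    points of weights 1, t, 1, take u = (1, 0, 0) and v = (1, 1, 0).  For M = 2
    and m = 1 this means f = (3, 2, 0) and g = (2, 1, 0); the expression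
    bounded above is t (t + 2), D(g, g) = 2 (t + 2), and the ratio
    t / (4 (t + 2)) tends to 1/4. *)

(** * Two real inequalities *)

Lemma psd_quadratic_discriminant (R : realFieldType) (A B C : R) :
  (forall s t, 0 <= s ^+ 2 * A + 2 * (s * t) * B + t ^+ 2 * C) ->
  0 <= A * C - B ^+ 2.
Proof.
move=> psd.
have A0 : 0 <= A by have := psd 1 0; nra.
have [Aeq0|An0] := eqVneq A 0.
  rewrite Aeq0.
  suff -> : B = 0 by rewrite mul0r expr0n subrr.
  apply/eqP/contraT => Bn0.
  (* Here the form is affine in s for t = 1; this s gives it the value -1. *)
  have := psd (- (C + 1) / (2 * B)) 1; rewrite Aeq0 mulr0 add0r.
  have -> : 2 * (- (C + 1) / (2 * B) * 1) * B = - (C + 1) by field.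
  by rewrite expr1n mul1r; lra.
have : 0 <= A * (A * C - B ^+ 2).
  suff -> : A * (A * C - B ^+ 2) =
      (- B) ^+ 2 * A + 2 * (- B * A) * B + A ^+ 2 * C by exact: psd.
  by ring.
by rewrite pmulr_rge0 // lt_def An0.
Qed.

(** The hypothesis bounds F G by a quadratic in X, and the right-hand side is
    the maximum over X of that quadratic minus X^2, reached at
    X = (M + m) G / 2. *)
Lemma gruss_of_reverse_cauchy_schwarz (R : realFieldType) (M m F G X : R) :
  F + M * m * G <= (M + m) * X -> 0 <= G ->
  F * G - X ^+ 2 <= 4^-1 * (M - m) ^+ 2 * G ^+ 2.
Proof.
move=> FGX G0; have := ler_wpM2r G0 FGX.
have := sqr_ge0 (X - (M + m) / 2 * G); nra.
Qed.

(** * Weighted products of square-integrable functions *)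

Section weighted_products.
Context (R : realType) (d : measure_display) (T : measurableType d).
Variables (mu : {measure set T -> \bar R}) (phi : T -> R).
Hypothesis phiw : weight phi.
Implicit Types u v w f g h : T -> R.

(** As the exceptional set need not be measurable, k is replaced by max(k, 0),
    which is measurable and almost everywhere equal to k. *)
Lemma Rintegral_ae_ge0 (k : T -> R) : measurable_fun [set: T] k ->
  {ae mu, forall x, 0 <= k x} -> 0 <= Rintegral mu [set: T] k.
Proof.
move=> mk k0; rewrite /Rintegral.
have /(_ _)-> := @ae_eq_integral _ _ _ mu [set: T]
  (fun x => (Num.max (k x) 0)%:E) (EFin \o k) measurableT.
- apply/fine_ge0/integral_ge0 => x _.
  by rewrite lee_fin le_max lexx orbT.
- exact/measurable_EFinP.
- by apply/measurable_EFinP; apply: measurable_maxr.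
- by apply: filterS k0 => x kx _ /=; rewrite max_l.
Qed.

Lemma measurable_weighted_mul f g :
  measurable_fun [set: T] f -> measurable_fun [set: T] g ->
  measurable_fun [set: T] (fun x => phi x * f x * g x).
Proof.
case: phiw => mphi _ mf mg.
by apply: measurable_funM => //; apply: measurable_funM.
Qed.

Lemma L2w_sqr_integrable f : L2w mu phi f ->
  mu.-integrable [set: T] (EFin \o (fun x => phi x * f x * f x)).
Proof.
move=> [mf fi]; apply/integrableP; split.
  by apply/measurable_EFinP; exact: measurable_weighted_mul.
apply: le_lt_trans fi; rewrite le_eqVlt; apply/orP; left; apply/eqP.
apply: eq_integral => x _ /=; congr EFin.
rewrite real_normK ?num_real// -mulrA normrM ger0_norm ?phiw.2//.
by rewrite -expr2 ger0_norm ?sqr_ge0.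
Qed.

(** Domination by phi f^2 + phi g^2. *)
Lemma L2w_integrable f g : L2w mu phi f -> L2w mu phi g ->
  mu.-integrable [set: T] (EFin \o (fun x => phi x * f x * g x)).
Proof.
move=> Lf Lg.
have := integrableD measurableT (L2w_sqr_integrable Lf) (L2w_sqr_integrable Lg).
apply: le_integrable => // [|x _ /=].
  by case: Lf Lg => mf _ [mg _]; exact/measurable_EFinP/measurable_weighted_mul.
rewrite lee_fin; have p0 := phiw.2 x.
rewrite (@ger0_norm _ (_ + _)); last first.
  by apply: addr_ge0; rewrite -mulrA -expr2 mulr_ge0// sqr_ge0.
rewrite -!mulrA -mulrDr normrM ger0_norm// ler_wpM2l//.
have := sqr_ge0 (f x + g x); have := sqr_ge0 (f x - g x).
by rewrite ler_norml => *; apply/andP; split; nra.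
Qed.

Lemma L2w_lincomb (a b : R) f g : L2w mu phi f -> L2w mu phi g ->
  L2w mu phi (fun x => a * f x + b * g x).
Proof.
move=> Lf Lg; split.
  by case: Lf Lg => mf _ [mg _]; apply: measurable_funD; apply: measurable_funM.
have ffi := integrableZl measurableT (a ^+ 2) (L2w_sqr_integrable Lf).
have fgi := integrableZl measurableT (2 * a * b) (L2w_integrable Lf Lg).
have ggi := integrableZl measurableT (b ^+ 2) (L2w_sqr_integrable Lg).
have := integrable_lty measurableT
  (integrableD measurableT ffi (integrableD measurableT fgi ggi)).
apply: le_lt_trans; rewrite le_eqVlt; apply/orP; left; apply/eqP.
apply: eq_integral => x _ /=; congr EFin.
rewrite real_normK ?num_real//; ring.
Qed.

Lemma wintC f g : wint mu phi f g = wint mu phi g f.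
Proof. by congr Rintegral; apply/funext => x; rewrite mulrAC. Qed.

Lemma wint_lincomb (a b : R) f g w :
  L2w mu phi f -> L2w mu phi g -> L2w mu phi w ->
  wint mu phi (fun x => a * f x + b * g x) w =
  a * wint mu phi f w + b * wint mu phi g w.
Proof.
move=> Lf Lg Lw.
have fi := L2w_integrable Lf Lw.
have gi := L2w_integrable Lg Lw.
rewrite /wint -!RintegralZl// -RintegralD//; first last.
- exact: (integrableZl measurableT b gi).
- exact: (integrableZl measurableT a fi).
by congr Rintegral; apply/funext => x; ring.
Qed.

(** * The determinant form and Chebyshev's inequality *)

(** When int phi h^2 > 0 and h is almost everywhere nonzero, this is
    (int phi h^2)^2 times the covariance of u / h and v / h under the
    normalized weight phi h^2. *)
Definition gram h u v : R :=
  wint mu phi u v * wint mu phi h h - wint mu phi u h * wint mu phi v h.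

Lemma gramC h u v : gram h u v = gram h v u.
Proof. by rewrite /gram (wintC u v); ring. Qed.

Lemma gram_lincomb h (a b : R) f g w :
  L2w mu phi h -> L2w mu phi f -> L2w mu phi g -> L2w mu phi w ->
  gram h (fun x => a * f x + b * g x) w = a * gram h f w + b * gram h g w.
Proof. by move=> Lh Lf Lg Lw; rewrite /gram !wint_lincomb//; ring. Qed.

(** Integrating the hypothesis against phi(y), then against phi(x), yields
    0 <= 2 gram h u v.  The condition is stated without quotients, so that it
    applies both to synchronous u/h and v/h and, trivially, to u = v. *)
Lemma gram_ge0 h u v : L2w mu phi h -> L2w mu phi u -> L2w mu phi v ->
  {ae mu, forall x, {ae mu, forall y,
     0 <= (u x * h y - u y * h x) * (v x * h y - v y * h x)}} ->
  0 <= gram h u v.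
Proof.
move=> Lh Lu Lv sync.
set p := fun x y => u x * h y + - h x * u y.
set q := fun x y => v x * h y + - h x * v y.
have Lp x : L2w mu phi (p x) by exact: L2w_lincomb.
have Lq x : L2w mu phi (q x) by exact: L2w_lincomb.
(* Grouping the inner integral by u(x) and h(x) turns the outer one into a sum
   of two weighted products. *)
set a := fun x => wint mu phi h h * v x + - wint mu phi v h * h x.
set b := fun x => wint mu phi u v * h x + - wint mu phi u h * v x.
have La : L2w mu phi a by exact: L2w_lincomb.
have Lb : L2w mu phi b by exact: L2w_lincomb.
have rowE x : wint mu phi (p x) (q x) = u x * a x + h x * b x.
  rewrite wint_lincomb// ![wint mu phi _ (q x)]wintC !wint_lincomb//.
  by rewrite (wintC h u) (wintC v u) /a /b; ring.
have row_ge0 : {ae mu, forall x, 0 <= phi x * u x * a x + phi x * h x * b x}.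
  apply: filterS sync => x sx.
  rewrite -!mulrA -mulrDr -rowE mulr_ge0 ?phiw.2//.
  apply: Rintegral_ae_ge0.
    by apply: measurable_weighted_mul; [case: (Lp x)|case: (Lq x)].
  apply: filterS sx => y; rewrite -mulrA => sxy.
  by rewrite mulr_ge0 ?phiw.2// /p /q !mulNr !(mulrC (h x)).
have ua := L2w_integrable Lu La.
have hb := L2w_integrable Lh Lb.
have : 0 <= wint mu phi u a + wint mu phi h b.
  rewrite /wint -RintegralD//; apply: Rintegral_ae_ge0 row_ge0.
  by apply: measurable_funD; apply/measurable_EFinP;
    [case/integrableP: ua|case/integrableP: hb].
rewrite (wintC u a) (wintC h b) !wint_lincomb//.
by rewrite (wintC v u) (wintC h u) /gram; lra.
Qed.

Lemma gram_diag_ge0 h u : L2w mu phi h -> L2w mu phi u -> 0 <= gram h u u.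
Proof.
move=> Lh Lu; apply: gram_ge0 => //.
by apply: aeW => x; apply: aeW => y; rewrite -expr2 sqr_ge0.
Qed.

Lemma gram_cauchy_schwarz h f g :
  L2w mu phi h -> L2w mu phi f -> L2w mu phi g ->
  0 <= gram h f f * gram h g g - gram h f g ^+ 2.
Proof.
move=> Lh Lf Lg; apply: psd_quadratic_discriminant => s t.
set w := fun x => s * f x + t * g x.
have Lw : L2w mu phi w by exact: L2w_lincomb.
have := gram_diag_ge0 Lh Lw.
rewrite gram_lincomb// ![gram h _ w]gramC !gram_lincomb// (gramC h g f).
by congr (0 <= _); ring.
Qed.

(** This is the expansion of 0 <= gram h (M g - f) (f - m g). *)
Lemma gram_reverse_cauchy_schwarz (M m : R) f g h :
  L2w mu phi h -> L2w mu phi f -> L2w mu phi g ->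
  {ae mu, forall x, h x != 0} ->
  synchronous mu (fun x => M * (g x / h x) - f x / h x)
                 (fun x => f x / h x - m * (g x / h x)) ->
  gram h f f + M * m * gram h g g <= (M + m) * gram h f g.
Proof.
move=> Lh Lf Lg hn0 sync.
set u := fun x => M * g x + -1 * f x.
set v := fun x => 1 * f x + - m * g x.
have Lu : L2w mu phi u by exact: L2w_lincomb.
have Lv : L2w mu phi v by exact: L2w_lincomb.
have : 0 <= gram h u v.
  apply: gram_ge0 => //; move: (hn0); apply: filterS2 sync => x sx hx.
  apply: filterS2 hn0 sx => y hy sxy.
  have -> : (u x * h y - u y * h x) * (v x * h y - v y * h x) =
    (h x * h y) ^+ 2 *
    ((M * (g x / h x) - f x / h x - (M * (g y / h y) - f y / h y)) *
     (f x / h x - m * (g x / h x) - (f y / h y - m * (g y / h y)))).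
    by rewrite /u /v; field; rewrite hx hy.
  by rewrite mulr_ge0 ?sqr_ge0.
rewrite gram_lincomb// ![gram h _ v]gramC !gram_lincomb// (gramC h g f).
lra.
Qed.

End weighted_products.

(** * Sharpness of the constant *)

Lemma integral_msum_dirac (R : realType) (N : nat) (k : nat -> R) :
  (forall n, 0 <= k n) ->
  (\int[msum (fun n => dirac n) N]_x (k x)%:E = (\sum_(i < N) k i)%:E)%E.
Proof.
move=> k0; rewrite ge0_integral_measure_sum//; last first.
  by move=> x _; rewrite lee_fin.
rewrite -sumEFin; apply: eq_bigr => i _.
by rewrite integral_dirac// diracT mul1e.
Qed.

Theorem proposition3p1 (R : realType) :
  (forall (d : measure_display) (T : measurableType d)
      (mu : {measure set T -> \bar R}) (phi : T -> R) (M m : R)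
      (f g h : T -> R),
    weight phi -> 0 < m -> m < M -> admissible mu phi M m f g h ->
    let I := wint mu phi in
    0 <= \det (mx2 (I f f) (I f h) (I f h) (I h h))
           * \det (mx2 (I g g) (I g h) (I g h) (I h h))
         - \det (mx2 (I f g) (I f h) (I g h) (I h h)) ^+ 2
      <= 4^-1 * (M - m) ^+ 2
           * \det (mx2 (I g g) (I g h) (I g h) (I h h)) ^+ 2)
  /\
  (forall C : R, C < 4^-1 ->
    ~ (forall (d : measure_display) (T : measurableType d)
         (mu : {measure set T -> \bar R}) (phi : T -> R) (M m : R)
         (f g h : T -> R),
       weight phi -> 0 < m -> m < M -> admissible mu phi M m f g h ->
       let I := wint mu phi in
       \det (mx2 (I f f) (I f h) (I f h) (I h h))
         * \det (mx2 (I g g) (I g h) (I g h) (I h h))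
       - \det (mx2 (I f g) (I f h) (I g h) (I h h)) ^+ 2
       <= C * (M - m) ^+ 2
            * \det (mx2 (I g g) (I g h) (I g h) (I h h)) ^+ 2)).
Proof.
split.
- move=> d T mu phi M m f g h phiw m0 mM [Lf Lg Lh h0 sync]; cbv zeta.
  rewrite !det_mx2.
  apply/andP; split; first exact: gram_cauchy_schwarz.
  apply: gruss_of_reverse_cauchy_schwarz.
    exact: gram_reverse_cauchy_schwarz sync.
  exact: gram_diag_ge0.
- move=> C C4 bound.
  (* Any t > 8 C / (1 - 4 C) makes t / (4 (t + 2)) exceed C. *)
  set t := 1 + `|8 * C| / (1 - 4 * C).
  have C41 : 0 < 1 - 4 * C by lra.
  have t0 : 0 < t by rewrite ltr_pwDl// divr_ge0// ltW.
  have tC : 8 * C < t * (1 - 4 * C).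
    have -> : t * (1 - 4 * C) = 1 - 4 * C + `|8 * C|.
      by rewrite /t; field; rewrite gt_eqF.
    by have := ler_norm (8 * C); lra.
  (* The points are 0, 1, 2; past its list, nth returns the default value 0. *)
  pose mu : {measure set nat -> \bar R} := msum (fun n => \d_n) 3.
  pose phi : nat -> R := nth 0 [:: 1; t; 1].
  pose f : nat -> R := nth 0 [:: 3; 2].
  pose g : nat -> R := nth 0 [:: 2; 1].
  have phiw : weight phi.
    by split => // -[|[|[|n]]] /=; rewrite /phi /= ?nth_nil ?ler01 // ltW.
  have L2 u : L2w mu phi u.
    split => //; rewrite integral_msum_dirac ?ltry// => n.
    by rewrite mulr_ge0 ?sqr_ge0 ?phiw.2.
  have adm : admissible mu phi 2 1 f g (fun=> 1).
    split => //.
    + by apply: aeW => x; exact: oner_neq0.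
    + apply: aeW => x; apply: aeW => y; rewrite !invr1 !mulr1 /f /g.
      by case: x => [|[|x]]; case: y => [|[|y]] /=; rewrite ?nth_nil; lra.
  have wintE u v : (forall n, 0 <= u n) -> (forall n, 0 <= v n) ->
      wint mu phi u v = u 0 * v 0 + t * (u 1 * v 1) + u 2 * v 2.
    move=> u0 v0; rewrite /wint /Rintegral integral_msum_dirac; last first.
      by move=> n; rewrite !mulr_ge0 ?phiw.2.
    by rewrite !big_ord_recl big_ord0 /= /phi /=; ring.
  have f0 n : 0 <= f n by rewrite /f; case: n => [|[|n]] /=; rewrite ?nth_nil.
  have g0 n : 0 <= g n by rewrite /g; case: n => [|[|n]] /=; rewrite ?nth_nil.
  have := bound _ _ mu phi 2 1 f g (fun=> 1) phiw ltr01 (ltr1n _ 2) adm.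
  cbv zeta; rewrite !det_mx2 !wintE// /f /g /=.
  nra.
Qed.
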